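(* Let $X$ be a path connected topological space and let $p:\tilde X\to X$ be a semicovering map. If $X$ is an SLT space, then $\tilde X$ is an SLT space.
   Context: $\ast$ denotes concatenation of paths and $\alpha^{-1}$ the reverse path. A space $Y$ is SLT at a point $y_0$ if for every path $\alpha$ in $Y$ with $\alpha(0)=y_0$ and every neighborhood $U$ of $y_0$ there is a neighborhood $V$ of $\alpha(1)$ such that for every loop $\beta$ in $V$ based at $\alpha(1)$ there is a loop $\gamma$ in $U$ based at $y_0$ homotopic to $\alpha\ast\beta\ast\alpha^{-1}$ relative to endpoints. $Y$ is an SLT space if it is SLT at every point. A semicovering map (Brazas) is a local homeomorphism $p:\tilde X\to X$ with continuous lifting of paths and homotopies: for every $\tilde x\in\tilde X$, composition with $p$ induces a homeomorphism from the space of paths in $\tilde X$ starting at $\tilde x$ to the space of paths in $X$ starting at $p(\tilde x)$, and a homeomorphism from the space of based maps $(D^2,(1,0))\to(\tilde X,\tilde x)$ to the space of based maps $(D^2,(1,0))\to(X,p(\tilde x))$, where $D^2$ is the closed unit disk and all mapping spaces carry the compact-open topology. *)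

(* Defs.v *)
From HB Require Import structures.
From mathcomp Require Import all_boot all_order all_algebra.
From mathcomp Require Import all_classical all_reals.
From mathcomp Require Import topology normedtype homotopy.
From mathcomp Require Import lra.

Set Implicit Arguments.
Unset Strict Implicit.
Unset Printing Implicit Defensive.

Import Order.TTheory GRing.Theory Num.Theory.
Import numFieldNormedType.Exports.

Local Open Scope classical_set_scope.
Local Open Scope ring_scope.

Definition unit_interval (R : realType) : Type := set_type `[0 : R, 1]%classic.

Section unit_interval.
Context {R : realType}.

HB.instance Definition _ := Topological.copy (unit_interval R)
  (set_type `[0 : R, 1]%classic).

Definition unit_val (t : unit_interval R) : R := val t.

Lemma unit_clamp_subproof (x : R) :
  Num.max 0 (Num.min 1 x) \in `[0 : R, 1]%classic.
Proof. by rewrite inE /= in_itv /= le_max lexx ge_max ler01 ge_min lexx. Qed.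

(* The retraction of R onto [0, 1]; it is applied below only to arguments
   already in [0, 1], where it is the identity. *)
Definition unit_clamp (x : R) : unit_interval R :=
  SigSub (unit_clamp_subproof x).

Lemma val_unit_clamp (x : R) : x \in `[0, 1] -> unit_val (unit_clamp x) = x.
Proof.
rewrite in_itv /= => /andP[x0 x1].
by rewrite /unit_val /= (min_idPr x1) (max_idPr x0).
Qed.

Lemma unit_clamp_neq : unit_clamp 0 != unit_clamp 1.
Proof.
apply/eqP => /(congr1 unit_val).
rewrite !val_unit_clamp ?in_itv /= ?lexx ?ler01 // => /eqP.
by rewrite eq_sym oner_eq0.
Qed.

HB.instance Definition _ :=
  @isBiPointed.Build (unit_interval R) (unit_clamp 0) (unit_clamp 1)
    unit_clamp_neq.

Lemma val_unit_zero : unit_val (zero : unit_interval R) = 0.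
Proof. by rewrite val_unit_clamp // in_itv /= lexx ler01. Qed.

Lemma val_unit_one : unit_val (one : unit_interval R) = 1.
Proof. by rewrite val_unit_clamp // in_itv /= lexx ler01. Qed.

Lemma unit_val_continuous : continuous unit_val.
Proof. exact: initial_continuous. Qed.

Lemma double_unit_val_continuous :
  continuous (fun t : unit_interval R => 2 * unit_val t).
Proof.
move=> t; apply: (@continuous_comp _ _ _ unit_val ( *%R 2)).
  exact: unit_val_continuous.
exact: mulrl_continuous.
Qed.

Lemma unit_clamp_continuous : continuous unit_clamp.
Proof.
apply: continuous_comp_initial => x.
apply: (@continuous_max R R (fun=> 0) (fun x => Num.min 1 x)).
  exact: cvg_cst.
apply: (@continuous_min R R (fun=> 1) id); first exact: cvg_cst.
exact: cvg_id.
Qed.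

End unit_interval.

Section path_operations.
Context {R : realType} {T : topologicalType}.
Local Notation I := (unit_interval R).

Definition path_concat_fun (f g : I -> T) (t : I) : T :=
  if unit_val t <= 2^-1 then f (unit_clamp (2 * unit_val t))
  else g (unit_clamp (2 * unit_val t - 1)).

Definition path_rev_fun (f : I -> T) (t : I) : T :=
  f (unit_clamp (1 - unit_val t)).

Section concat.
Context (x y z : T) (f : {path I from x to y}) (g : {path I from y to z}).

Lemma path_concat_continuous : continuous (path_concat_fun f g).
Proof.
have cf : continuous (fun t : I => f (unit_clamp (2 * unit_val t))).
  move=> t;
  apply: (@continuous_comp _ _ _ (fun t : I => unit_clamp (2 * unit_val t)));
    last exact: cts_fun.
  apply: (@continuous_comp _ _ _ (fun t : I => 2 * unit_val t) unit_clamp);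
    last exact: unit_clamp_continuous.
  exact: double_unit_val_continuous.
have cg : continuous (fun t : I => g (unit_clamp (2 * unit_val t - 1))).
  move=> t;
  apply: (@continuous_comp _ _ _
    (fun t : I => unit_clamp (2 * unit_val t - 1)));
    last exact: cts_fun.
  apply: (@continuous_comp _ _ _ (fun t : I => 2 * unit_val t - 1) unit_clamp);
    last exact: unit_clamp_continuous.
  apply: (@continuousB R); last exact: cst_continuous.
  exact: double_unit_val_continuous.
pose A := [set t : I | unit_val t <= 2^-1].
pose B := [set t : I | 2^-1 <= unit_val t].
have /continuous_closedP cval := @unit_val_continuous R.
have cA : closed A := cval _ (@closed_le R 2^-1).
have cB : closed B := cval _ (@closed_ge R 2^-1).
have AB : A `|` B = setT.
  apply/seteqP; split=> // t _; rewrite /A /B /=.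
  by case: (leP (unit_val t) 2^-1) => [|/ltW]; [left|right].
apply/continuous_subspace_setT; rewrite -AB; apply: withinU_continuous => //.
  apply: (@subspace_eq_continuous _ _ _
    (fun t : I => f (unit_clamp (2 * unit_val t)))).
    by move=> t /set_mem At; rewrite /path_concat_fun /from_subspace/= At.
  exact: continuous_subspaceT.
apply: (@subspace_eq_continuous _ _ _
  (fun t : I => g (unit_clamp (2 * unit_val t - 1)))).
  move=> t /set_mem Bt; rewrite /path_concat_fun /from_subspace/=.
  case: ifPn => // At.
  have -> : unit_val t = 2^-1 by apply/eqP; rewrite eq_le At Bt.
  rewrite (_ : 2 * 2^-1 = 1) ?subrr; last by rewrite mulfV ?pnatr_eq0.
  by rewrite -[unit_clamp 0]/zero -[unit_clamp 1]/one path_zero path_one.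
exact: continuous_subspaceT.
Qed.

Lemma path_concat_zero : path_concat_fun f g zero = x.
Proof.
rewrite /path_concat_fun val_unit_zero invr_ge0 ler0n mulr0.
exact: path_zero.
Qed.

Lemma path_concat_one : path_concat_fun f g one = z.
Proof.
rewrite /path_concat_fun val_unit_one ifF; last by apply/negbTE; lra.
rewrite (_ : 2 * 1 - 1 = 1); last by lra.
exact: path_one.
Qed.

Definition path_concat : {path I from x to z} :=
  mk_path path_concat_continuous path_concat_zero path_concat_one.

End concat.

Section rev.
Context (x y : T) (f : {path I from x to y}).

Lemma path_rev_continuous : continuous (path_rev_fun f).
Proof.
move=> t;
apply: (@continuous_comp _ _ _ (fun t : I => unit_clamp (1 - unit_val t)));
  last exact: cts_fun.
apply: (@continuous_comp _ _ _ (fun t : I => 1 - unit_val t) unit_clamp);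
  last exact: unit_clamp_continuous.
apply: (@continuousB R); first exact: cst_continuous.
exact: unit_val_continuous.
Qed.

Lemma path_rev_zero : path_rev_fun f zero = y.
Proof. by rewrite /path_rev_fun val_unit_zero subr0; exact: path_one. Qed.

Lemma path_rev_one : path_rev_fun f one = x.
Proof. by rewrite /path_rev_fun val_unit_one subrr; exact: path_zero. Qed.

Definition path_rev : {path I from y to x} :=
  mk_path path_rev_continuous path_rev_zero path_rev_one.

End rev.

Definition path_homotopic (x y : T) (f g : {path I from x to y}) : Prop :=
  exists H : I * I -> T,
    [/\ continuous H,
        forall t, H (t, zero) = f t,
        forall t, H (t, one) = g t,
        forall s, H (zero, s) = x &
        forall s, H (one, s) = y].

End path_operations.

Definition path_connected_space (R : realType) (X : topologicalType) : Prop :=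
  forall x y : X, exists _ : {path (unit_interval R) from x to y}, True.

Definition SLT_at (R : realType) (Y : topologicalType) (y0 : Y) : Prop :=
  forall (y1 : Y) (alpha : {path (unit_interval R) from y0 to y1}) (U : set Y),
    nbhs y0 U ->
    exists2 V : set Y, nbhs y1 V &
      forall beta : {path (unit_interval R) from y1 to y1}, range beta `<=` V ->
        exists2 gamma : {path (unit_interval R) from y0 to y0},
          range gamma `<=` U &
          path_homotopic gamma
            (path_concat (path_concat alpha beta) (path_rev alpha)).

Definition SLT_space (R : realType) (Y : topologicalType) : Prop :=
  forall y0 : Y, SLT_at R y0.

Definition homeomorphism (X Y : topologicalType) (f : X -> Y) : Prop :=
  continuous f /\ exists g : Y -> X, [/\ continuous g, cancel f g & cancel g f].

(* [sigLR [fun f in U]] is the restriction of f seen as a map from the subspace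
   U to the subspace f @` U. *)
Definition local_homeomorphism (X Y : topologicalType) (f : X -> Y) : Prop :=
  forall x : X, exists U : set X,
    [/\ open U, U x, open (f @` U) & homeomorphism (sigLR [fun f in U])].

Section based_maps.
Context {A : topologicalType} (a : A) {X : topologicalType} (x : X).

(* Based continuous maps (A, a) -> (X, x); the topology is the one induced from
   the compact-open topology on all functions. *)
Definition based_map : Type := set_type [set f : continuousType A X | f a = x].

HB.instance Definition _ := Choice.on based_map.

Definition based_map_fun (f : based_map) : {compact-open, A -> X} := val f.

HB.instance Definition _ :=
  Topological.copy based_map (initial_topology based_map_fun).

End based_maps.

Section based_comp.
Context {A : topologicalType} (a : A) {X Y : topologicalType}.
Context (p : continuousType X Y) (x : X).

Lemma based_comp_subproof (f : based_map a x) :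
  (p \o val f : continuousType A Y) \in
    [set g : continuousType A Y | g a = p x].
Proof. by apply/mem_set => /=; rewrite (set_valP f). Qed.

Definition based_comp (f : based_map a x) : based_map a (p x) :=
  SigSub (based_comp_subproof f).

End based_comp.
Arguments based_comp {A} a {X Y} p x f.

Definition disk (R : realType) : Type :=
  set_type [set z : R * R | z.1 ^+ 2 + z.2 ^+ 2 <= 1].

HB.instance Definition _ (R : realType) := Topological.copy (disk R)
  (set_type [set z : R * R | z.1 ^+ 2 + z.2 ^+ 2 <= 1]).

Lemma disk_base_subproof (R : realType) :
  (1, 0) \in [set z : R * R | z.1 ^+ 2 + z.2 ^+ 2 <= 1].
Proof. by apply/mem_set; rewrite /= expr1n expr0n addr0. Qed.

Definition disk_base (R : realType) : disk R :=
  SigSub (disk_base_subproof R).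

Definition semicovering (R : realType) (Xt X : topologicalType)
    (p : continuousType Xt X) : Prop :=
  [/\ local_homeomorphism p,
      forall xt : Xt, homeomorphism (based_comp (zero : unit_interval R) p xt) &
      forall xt : Xt, homeomorphism (based_comp (disk_base R) p xt)].

(* Main.v *)
Require Import Defs.
From mathcomp Require Import all_boot all_order all_algebra.
From mathcomp Require Import all_classical all_reals.
From mathcomp Require Import topology normedtype homotopy.
From mathcomp Require Import lra.

(** The SLT property is pulled back along [p] by projecting to [X], using it
    there, and lifting the result.  Given a path [alpha] from [x0] to [x1] and
    a neighbourhood [U] of [x0] in [Xt], the local inverse of [p] at [x0]
    turns maps into a small neighbourhood [N] of [p x0] into maps into [U]
    ([local_homeomorphism_lift]).  Applying the SLT property of [X] to
    [p \o alpha] and [N] gives a neighbourhood [V] of [p x1], and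
    [p @^-1` V] is the neighbourhood wanted: for a loop [beta] in it, the
    projected loop [alpha * beta * alpha^-1] is homotopic to a loop [gamma] in
    [N], the local inverse sends [gamma] to a loop in [U], and the homotopy
    lifts to [Xt].

    The lifted homotopy has the right boundary because lifts of paths are
    unique: its four sides lift known paths, two of them constant, and have
    known starting points ([semicovering_homotopic_lift]).  Its existence comes
    from the lifting of based maps of the disk, since the square embeds in the
    disk as a retract with a corner sent to the base point
    ([square_to_diskK], [semicovering_square_lift]). *)

Set Implicit Arguments.
Unset Strict Implicit.
Unset Printing Implicit Defensive.

Import Order.TTheory GRing.Theory Num.Theory.
Import numFieldNormedType.Exports.

Local Open Scope classical_set_scope.
Local Open Scope ring_scope.

(** * Lifting small maps through a local homeomorphism *)

(** Composing with the local inverse of [f] at [y] lifts all maps into [N] at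
    once.  The last clause is what makes the lift of a loop based at [f y] a
    loop: the lift of [g a] depends only on the point [g a]. *)
Lemma local_homeomorphism_lift (Y X : topologicalType) (f : Y -> X) (y : Y)
    (U : set Y) :
  local_homeomorphism f -> nbhs y U ->
  exists2 N : set X, nbhs (f y) N &
    forall (A : topologicalType) (g : A -> X), continuous g ->
      range g `<=` N ->
      exists gt : A -> Y, [/\ continuous gt, range gt `<=` U,
        forall a, f (gt a) = g a & forall a, g a = f y -> gt a = y].
Proof.
move=> /(_ y)[W [oW Wy ofW [_ [s [cs fK sK]]]]] Uy.
pose u : W := SigSub (mem_set Wy).
have : nbhs (sigLR [fun f in W] u) (s @^-1` (set_val @^-1` U)).
  apply: cs; rewrite fK.
  exact: (@initial_continuous _ _ (set_val : W -> Y)).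
case=> _ [[O oO <-] Ou OsU].
exists (O `&` f @` W).
  by apply: filterI; apply: open_nbhs_nbhs; split => //; exists y.
move=> A g cg gN.
have fWg a : g a \in f @` W by apply/mem_set; apply: (gN (g a) _).2; exists a.
pose h a : f @` W := SigSub (fWg a).
have ch : continuous h by exact: continuous_comp_initial.
exists (fun a => set_val (s (h a))); split.
- move=> a; apply: (@continuous_comp _ _ _ (s \o h)).
    by apply: continuous_comp; [exact: ch | exact: cs].
  exact: (@initial_continuous _ _ (set_val : W -> Y)).
- by move=> _ [a _ <-]; apply: OsU; apply: (gN (g a) _).1; exists a.
- by move=> a; rewrite -[RHS]/(set_val (h a)) -[in RHS](sK (h a)).
- move=> a gay; rewrite (_ : h a = sigLR [fun f in W] u) ?fK //.
  exact: val_inj.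
Qed.

(** * Lifting based maps *)

Section based_lifting.
Context {A : topologicalType} (a : A) {Y X : topologicalType}.
Context (p : continuousType Y X).

Lemma based_lift_unique (f g : continuousType A Y) :
  injective (based_comp a p (f a)) -> g a = f a ->
  (forall t, p (g t) = p (f t)) -> g =1 f.
Proof.
move=> pinj ga pgf.
pose F : based_map a (f a) :=
  SigSub (mem_set (erefl (f a)) :
    f \in [set h : continuousType A Y | h a = f a]).
pose G : based_map a (f a) :=
  SigSub (mem_set ga : g \in [set h : continuousType A Y | h a = f a]).
suff /(congr1 val)/= -> : G = F by [].
apply: pinj; apply: val_inj; exact/continuousEP.
Qed.

Lemma based_lift_exists (y : Y) (g : continuousType A X) :
  homeomorphism (based_comp a p y) -> g a = p y ->
  exists gt : continuousType A Y, gt a = y /\ forall t, p (gt t) = g t.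
Proof.
move=> [_ [s [_ _ sK]]] ga.
pose G : based_map a (p y) :=
  SigSub (mem_set ga : g \in [set h : continuousType A X | h a = p y]).
exists (val (s G)); split; first exact: (set_valP (s G)).
move=> t; have /(congr1 val)/continuousEP/(_ t) := sK G; exact.
Qed.

End based_lifting.

(** * The square as a based retract of the disk *)

(** [cvg_pair] stated for continuity at a point, a form in which the product
    topology on the codomain is visible to unification. *)
Lemma pair_continuous_at (T U V : topologicalType) (f : T -> U) (g : T -> V)
    (x : T) :
  {for x, continuous f} -> {for x, continuous g} ->
  {for x, continuous (fun t => (f t, g t))}.
Proof. exact: cvg_pair. Qed.

Section square_in_disk.
Context {R : realType}.
Local Notation I := (unit_interval R).

Lemma unit_val_itv (t : I) : 0 <= unit_val t <= 1.
Proof. by have := set_valP t; rewrite /= in_itv. Qed.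

Lemma unit_valK : cancel (@unit_val R) unit_clamp.
Proof.
by move=> t; apply: val_inj; apply: val_unit_clamp; exact: unit_val_itv.
Qed.

(** The square is turned by 45 degrees and scaled so that its diagonal from
    [(0, 0)] to [(1, 1)] becomes the radius from the base point [(1, 0)] of the
    disk to the centre. *)
Definition square_to_plane (z : I * I) : R * R :=
  (1 - 2^-1 * (unit_val z.1 + unit_val z.2),
   2^-1 * (unit_val z.2 - unit_val z.1)).

Lemma square_to_disk_subproof (z : I * I) :
  square_to_plane z \in [set z : R * R | z.1 ^+ 2 + z.2 ^+ 2 <= 1].
Proof.
apply/mem_set; rewrite /square_to_plane /=.
have /andP[] := unit_val_itv z.1; have /andP[] := unit_val_itv z.2.
move: (unit_val z.1) (unit_val z.2) => s t; nra.
Qed.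

Definition square_to_disk (z : I * I) : disk R :=
  SigSub (square_to_disk_subproof z).

(** The affine inverse of [square_to_plane], followed by the retraction of the
    plane onto the unit square that clamps each coordinate. *)
Definition disk_to_square (w : disk R) : I * I :=
  (unit_clamp (1 - (val w).1 - (val w).2),
   unit_clamp (1 - (val w).1 + (val w).2)).

(** This retraction lets a map of the square be extended to the disk, lifted
    there and restricted back. *)
Lemma square_to_diskK : cancel square_to_disk disk_to_square.
Proof.
move=> [s t]; rewrite /disk_to_square /=.
congr pair; rewrite -[RHS]unit_valK; congr unit_clamp; lra.
Qed.

Lemma square_to_disk_base : square_to_disk (zero, zero) = disk_base R.
Proof.
apply: val_inj; rewrite /= /square_to_plane /= !val_unit_zero.
by rewrite addr0 subrr mulr0 subr0.
Qed.

Lemma square_to_disk_continuous : continuous square_to_disk.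
Proof.
apply: continuous_comp_initial => z.
have c1 : (unit_val y.1 @[y --> z] --> unit_val z.1).
  apply: (@continuous_comp _ _ _ fst); first exact: cvg_fst.
  exact: unit_val_continuous.
have c2 : (unit_val y.2 @[y --> z] --> unit_val z.2).
  apply: (@continuous_comp _ _ _ snd); first exact: cvg_snd.
  exact: unit_val_continuous.
apply: (@pair_continuous_at _ _ _
  (fun z : I * I => 1 - 2^-1 * (unit_val z.1 + unit_val z.2))
  (fun z : I * I => 2^-1 * (unit_val z.2 - unit_val z.1))).
- apply: cvgB; first exact: cvg_cst.
  by apply: cvgM; [exact: cvg_cst | exact: cvgD].
- by apply: cvgM; [exact: cvg_cst | exact: cvgB].
Qed.

Lemma disk_to_square_continuous : continuous disk_to_square.
Proof.
move=> w; apply: (@continuous_comp (disk R) (R * R)%type (I * I)%type val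
  (fun z => (unit_clamp (1 - z.1 - z.2), unit_clamp (1 - z.1 + z.2)))).
  exact: initial_continuous.
apply: (@pair_continuous_at _ _ _
  (fun z : R * R => unit_clamp (1 - z.1 - z.2))
  (fun z : R * R => unit_clamp (1 - z.1 + z.2))).
- apply: (@continuous_comp _ _ _ (fun z : R * R => 1 - z.1 - z.2)).
    apply: cvgB; last exact: cvg_snd.
    by apply: cvgB; [exact: cvg_cst | exact: cvg_fst].
  exact: unit_clamp_continuous.
- apply: (@continuous_comp _ _ _ (fun z : R * R => 1 - z.1 + z.2)).
    apply: cvgD; last exact: cvg_snd.
    by apply: cvgB; [exact: cvg_cst | exact: cvg_fst].
  exact: unit_clamp_continuous.
Qed.

End square_in_disk.

(** * Lifting homotopies through a semicovering *)

Section semicovering_lifting.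
Context {R : realType} {Xt X : topologicalType} (p : continuousType Xt X).
Context (scp : semicovering R p).
Local Notation I := (unit_interval R).

Lemma semicovering_path_unique (f g : continuousType I Xt) :
  g zero = f zero -> (forall t, p (g t) = p (f t)) -> g =1 f.
Proof.
have [_ pP _] := scp; apply: based_lift_unique.
by have [_ [s [_ /can_inj]]] := pP (f zero).
Qed.

(** Extend [H] to the disk by precomposing with the retraction, lift, and
    restrict to the embedded square. *)
Lemma semicovering_square_lift (xt : Xt) (H : I * I -> X) :
  continuous H -> H (zero, zero) = p xt ->
  exists Ht : I * I -> Xt,
    [/\ continuous Ht, Ht (zero, zero) = xt & forall z, p (Ht z) = H z].
Proof.
move=> cH H0; have [_ _ dP] := scp.
have cHr : continuous (H \o disk_to_square).
  move=> w; apply: continuous_comp; first exact: disk_to_square_continuous.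
  exact: cH.
have Hr0 : mkcts cHr (disk_base R) = p xt.
  by rewrite /mkcts /= -square_to_disk_base square_to_diskK.
have [L [L0 pL]] := based_lift_exists (dP xt) Hr0.
exists (L \o square_to_disk); split.
- move=> z; apply: continuous_comp; first exact: square_to_disk_continuous.
  exact: cts_fun.
- by rewrite /= square_to_disk_base.
- by move=> z; rewrite -[in RHS](square_to_diskK z); exact: pL.
Qed.

(** Each side of the lifted square is determined by its initial point and its
    projection.  The corner [xt] starts the bottom and the left side; the
    bottom, once known, gives the start of the right side, and the left side
    that of the top. *)
Lemma semicovering_homotopic_lift (xt yt : Xt)
    (f g : {path I from p xt to p yt}) (ft gt : {path I from xt to yt}) :
  (forall t, p (ft t) = f t) -> (forall t, p (gt t) = g t) ->
  path_homotopic f g -> path_homotopic ft gt.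
Proof.
move=> pf pg [H [cH H0 H1 Hl Hr]].
have H00 : H (zero, zero) = p xt by rewrite Hl.
have [Ht [cHt Ht00 pH]] := semicovering_square_lift cH H00.
have crow s : continuous (fun t => Ht (t, s)).
  move=> t; apply: (@continuous_comp I (I * I)%type Xt
    (fun t => (t, s)) Ht); last exact: cHt.
  by apply: (@pair_continuous_at I I I id (fun=> s));
    [exact: cvg_id | exact: cst_continuous].
have ccol t : continuous (fun s => Ht (t, s)).
  move=> s; apply: (@continuous_comp I (I * I)%type Xt
    (fun s => (t, s)) Ht); last exact: cHt.
  by apply: (@pair_continuous_at I I I (fun=> t) id);
    [exact: cst_continuous | exact: cvg_id].
have bottom t : Ht (t, zero) = ft t.
  apply: (@semicovering_path_unique ft (mkcts (crow zero))) => [|u].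
    exact: etrans Ht00 (esym path_zero).
  by rewrite [RHS]pf -H0; exact: pH.
have left_side s : Ht (zero, s) = xt.
  apply: (@semicovering_path_unique (cst xt) (mkcts (ccol zero))) => // u.
  exact: etrans (pH _) (Hl _).
have right_side s : Ht (one, s) = yt.
  apply: (@semicovering_path_unique (cst yt) (mkcts (ccol one))) => [|u].
    exact: etrans (bottom _) path_one.
  exact: etrans (pH _) (Hr _).
have top t : Ht (t, one) = gt t.
  apply: (@semicovering_path_unique gt (mkcts (crow one))) => [|u].
    exact: etrans (left_side _) (esym path_zero).
  by rewrite [RHS]pg -H1; exact: pH.
by exists Ht.
Qed.

End semicovering_lifting.

(** * The SLT property lifts to semicoverings *)

Theorem corollary2p16 (R : realType) (Xt X : topologicalType)
    (p : continuousType Xt X) :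
  path_connected_space R X -> semicovering R p ->
  SLT_space R X -> SLT_space R Xt.
Proof.
move=> _ scp sltX x0 x1 alpha U Ux0.
have [lh _ _] := scp.
have [N Nx0 Nlift] := local_homeomorphism_lift lh Ux0.
have [V Vx1 Vloop] := sltX (p x0) (p x1) (p \o alpha) N Nx0.
exists (p @^-1` V); first exact: (@cts_fun _ _ p).
move=> beta betaV.
have pbetaV : range (p \o beta) `<=` V.
  by move=> _ [t _ <-]; apply: betaV; exists t.
have [gamma gammaN gammaH] := Vloop (p \o beta) pbetaV.
have [gt [cgt gtU pgt gtx0]] := Nlift _ gamma (@cts_fun _ _ gamma) gammaN.
have gt0 : gt zero = x0 by apply: gtx0; exact: path_zero.
have gt1 : gt one = x0 by apply: gtx0; exact: path_one.
exists (mk_path cgt gt0 gt1); first exact: gtU.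
apply: (semicovering_homotopic_lift scp _ _ gammaH); first exact: pgt.
(* Composition with [p] commutes with concatenation and reversal, pointwise. *)
move=> t; rewrite /path_concat /path_rev /= /mk_path /path_concat_fun /=.
by case: ifP => //= _; rewrite /path_concat_fun; case: ifP.
Qed.
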